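(* Let $p$ be an odd prime, let $G=(\mathbb{Z}/p\mathbb{Z})^2$, and identify $\widehat{G}$ with $(\mathbb{Z}/p\mathbb{Z})^2$ via the pairing $\langle(a,b),(c,d)\rangle=\zeta_p^{ac+bd}$, where $\zeta_p=e^{2\pi i/p}$. For all nonzero elements $\alpha$ and $\beta$ of $\mathbb{Z}/p\mathbb{Z}$, the subsets $S=\{(\alpha n^2,\beta n) \mid n\in\mathbb{Z}/p\mathbb{Z}\}\subseteq G$ and $T=\{(n,n^2) \mid n\in\mathbb{Z}/p\mathbb{Z}\}\subseteq\widehat{G}$ are formally dual to each other.
   Context: Let $G$ be a finite abelian group with character group $\widehat G$ and pairing $\langle\cdot,\cdot\rangle\colon G\times\widehat G\to S^1\subset\mathbb{C}^*$. Nonempty subsets $S\subseteq G$ and $T\subseteq\widehat G$ are formally dual if the following equivalent conditions hold: (1) for every $y\in\widehat G$, $\left|\frac{1}{|S|}\sum_{v\in S}\langle v,y\rangle\right|^2=\frac{1}{|T|}\cdot\#\{(w,w')\in T\times T \mid y=w-w'\}$; (2) for every $f\colon G\to\mathbb{C}$, $\frac{1}{|S|^{3/2}}\sum_{v,v'\in S}f(v-v')=\frac{1}{|T|^{3/2}}\sum_{w,w'\in T}\widehat f(w-w')$, where $\widehat f(y)=\frac{1}{\sqrt{|G|}}\sum_{x\in G}f(x)\overline{\langle x,y\rangle}$. *)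

(* Defs.v *)
From HB Require Import structures.
From mathcomp Require Import all_boot all_order all_algebra.
From mathcomp Require Import complex reals trigo lra.

Set Implicit Arguments.
Unset Strict Implicit.
Unset Printing Implicit Defensive.

Import Order.TTheory GRing.Theory Num.Theory.

Local Open Scope ring_scope.
Local Open Scope complex_scope.

(* Forces the join of the zmodType and finType structures on products, which  *)
(* MathComp does not infer on its own.                                        *)
HB.instance Definition _ (A B : finZmodType) := GRing.Zmodule.on (A * B)%type.

Definition is_character (R : realType) (G : finZmodType) (chi : G -> R[i]) :=
  (forall x, `|chi x| = 1) /\ {morph chi : x y / x + y >-> x * y}.

(* An identification of Gh with the character group of G: y |-> <-, y> is a   *)
(* group isomorphism from Gh onto the group of characters of G.               *)
Record char_pairing (R : realType) (G Gh : finZmodType) := CharPairing {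
  pairing_fun :> G -> Gh -> R[i];
  pairing_character : forall y, is_character (pairing_fun^~ y);
  pairingDr : forall x, {morph pairing_fun x : y z / y + z >-> y * z};
  pairing_bij : forall chi : G -> R[i], is_character chi ->
    exists! y, forall x, pairing_fun x y = chi x
}.

Definition formally_dual (R : realType) (G Gh : finZmodType)
    (pair : char_pairing R G Gh) (S : {set G}) (T : {set Gh}) : Prop :=
  [/\ S != set0, T != set0 &
    forall y : Gh,
      `| #|S|%:R^-1 * \sum_(v in S) pair v y | ^+ 2
      = #|T|%:R^-1 * #|[set w in setX T T | y == w.1 - w.2]|%:R :> R[i]].

Definition expi (R : realType) (x : R) : R[i] := cos x +i* sin x.

Definition zeta (R : realType) (p : nat) : R[i] := expi (2 * pi / p%:R).

Section ZetaTheory.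
Variable R : realType.
Implicit Types (x y : R) (p n : nat).

Lemma expi0 : expi (0 : R) = 1.
Proof. by rewrite /expi cos0 sin0. Qed.

Lemma expiD x y : expi (x + y) = expi x * expi y.
Proof.
by apply/eqP; rewrite eq_complex /= cosD sinD [cos x * sin y + _]addrC !eqxx.
Qed.

Lemma expi_exp x n : expi x ^+ n = expi (x *+ n).
Proof.
by elim: n => [|n IHn]; rewrite ?expr0 ?mulr0n ?expi0 // exprS IHn -expiD mulrS.
Qed.

Lemma norm_expi x : `|expi x| = 1.
Proof. by rewrite normc_def /= cos2Dsin2 sqrtr1. Qed.

Lemma zeta_prim p : (1 < p)%N -> p.-primitive_root (zeta R p).
Proof.
move=> p1; have p0 : (0 < p)%N := ltnW p1.
have pR0 : 0 < p%:R :> R by rewrite ltr0n.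
have zp1 : zeta R p ^+ p = 1.
  rewrite /zeta expi_exp -[_ *+ p]mulr_natr divfK ?gt_eqF // mulr_natl.
  by rewrite /expi cos2pi mulr2n sinD sinpi mul0r mulr0 addr0.
have [m m_prim m_dvd] := prim_order_exists p0 zp1.
suff m_eq : m = p by rewrite m_eq in m_prim.
have m0 : (0 < m)%N := prim_order_gt0 m_prim.
have m_le := dvdn_leq p0 m_dvd.
apply/eqP; rewrite eqn_leq m_le leqNgt; apply/negP => lt_mp.
have := prim_expr_order m_prim; rewrite /zeta expi_exp.
set t := pi * (m%:R / p%:R) : R.
have -> : (2 * pi / p%:R) *+ m = t + t :> R.
  by rewrite /t -[_ *+ m]mulr_natr; lra.
case=> + _; rewrite cosD -!expr2 => cosE.
have sin_t : 0 < sin t.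
  rewrite sin_gt0_pi // /t mulr_gt0 ?pi_gt0 ?divr_gt0 ?ltr0n //=.
  by rewrite -[X in _ < X]mulr1 ltr_pM2l ?pi_gt0 // ltr_pdivrMr // mul1r ltr_nat.
have := cos2Dsin2 t; have := exprn_gt0 2 sin_t; lra.
Qed.

End ZetaTheory.

Section ZpPairing.
Variables (R : realType) (p : nat).
Hypothesis p_gt1 : (1 < p)%N.

Local Notation V := ('Z_p * 'Z_p)%type.

Definition Zp2_pairing_fun (x y : V) : R[i] :=
  zeta R p ^+ (x.1 * y.1 + x.2 * y.2)%R.

Let z_prim := zeta_prim R p_gt1.

Lemma zeta_ZpD (a b : 'Z_p) :
  zeta R p ^+ (a + b)%R = zeta R p ^+ a * zeta R p ^+ b.
Proof.
rewrite -exprD -(prim_expr_mod z_prim (a + b)%N) /=.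
by congr (_ ^+ (_ %% _)%N); exact: Zp_cast.
Qed.

Lemma Zp2_pairing_character y : is_character (Zp2_pairing_fun^~ y).
Proof.
split=> [x | x x']; first by rewrite normrX norm_expi expr1n.
rewrite /Zp2_pairing_fun -zeta_ZpD -[(x + x').1]/(x.1 + x'.1).
by rewrite -[(x + x').2]/(x.2 + x'.2) !mulrDl addrACA.
Qed.

Lemma Zp2_pairingDr x :
  {morph Zp2_pairing_fun x : y z / y + z >-> y * z}.
Proof.
move=> y z; rewrite /Zp2_pairing_fun -zeta_ZpD -[(y + z).1]/(y.1 + z.1).
by rewrite -[(y + z).2]/(y.2 + z.2) !mulrDr addrACA.
Qed.

Lemma zeta_Zp_inj : injective (fun a : 'Z_p => zeta R p ^+ a).
Proof.
have lt_p (c : 'Z_p) : (c < p)%N by rewrite -[X in (_ < X)%N](Zp_cast p_gt1).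
move=> a b /eqP; rewrite (eq_prim_root_expr z_prim) !modn_small ?lt_p //.
by move/eqP/val_inj.
Qed.

Lemma characterMn (G : finZmodType) (chi : G -> R[i]) : is_character chi ->
  forall x n, chi (x *+ n) = chi x ^+ n.
Proof.
case=> chi1 chiD x; elim=> [|n IHn]; last by rewrite mulrS chiD IHn exprS.
have chi0 : chi 0 != 0 by rewrite -normr_gt0 chi1 ltr01.
by apply: (mulfI chi0); rewrite -chiD addr0 mulr1.
Qed.

Lemma mulrn_pair (a b : 'Z_p) n : ((a, b) : V) *+ n = (a *+ n, b *+ n).
Proof. by elim: n => [|n IHn]; rewrite ?mulr0n // !mulrS IHn. Qed.

Lemma character_Zp2 (chi : V -> R[i]) : is_character chi ->
  forall a b, chi (a, b) = chi (1, 0) ^+ a * chi (0, 1) ^+ b.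
Proof.
move=> chiP a b; rewrite -!characterMn // -(proj2 chiP) !mulrn_pair.
by rewrite !mul0rn !natr_Zp; congr (chi (_, _)); rewrite ?addr0 ?add0r.
Qed.

Lemma Zp2_pairing_bij (chi : V -> R[i]) : is_character chi ->
  exists! y, forall x, Zp2_pairing_fun x y = chi x.
Proof.
move=> chiP; have chip x : chi x ^+ p = 1.
  rewrite -characterMn //; case: x => a b; rewrite mulrn_pair.
  rewrite -[a *+ p]mulr_natr -[b *+ p]mulr_natr pchar_Zp // !mulr0.
  exact: (characterMn chiP 0 0).
have root_Zp x : exists c : 'Z_p, zeta R p ^+ c = chi x.
  have [i ->] := prim_rootP z_prim (chip x).
  by exists (cast_ord (esym (Zp_cast p_gt1)) i).
have [c cE] := root_Zp (1, 0); have [d dE] := root_Zp (0, 1).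
exists (c, d); split=> [[a b] | [c' d'] H].
  rewrite (character_Zp2 chiP) -cE -dE /Zp2_pairing_fun zeta_ZpD /=.
  have M (u v : 'Z_p) : zeta R p ^+ (u * v)%R = (zeta R p ^+ v) ^+ u.
    rewrite -exprM -(prim_expr_mod z_prim (v * u)) mulnC /=.
    by congr (_ ^+ (_ %% _)%N); exact: Zp_cast.
  by rewrite !M.
congr (_, _); apply: zeta_Zp_inj.
  rewrite cE -H; congr (_ ^+ nat_of_ord _).
  by rewrite -[LHS]/(1 * c' + 0 * d') mul1r mul0r addr0.
rewrite dE -H; congr (_ ^+ nat_of_ord _).
by rewrite -[LHS]/(0 * c' + 1 * d') mul1r mul0r add0r.
Qed.

Definition Zp2_pairing : char_pairing R V V :=
  CharPairing Zp2_pairing_character Zp2_pairingDr Zp2_pairing_bij.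

End ZpPairing.

(* Main.v *)
(* Write e(a) = zeta^a.  For y = (c, d) the character sum over S is
   sum_n e(k n^2 + l n) with k = alpha c and l = beta d.  If c = 0 it is a
   complete linear sum, equal to p or 0 according to whether d = 0.  If c <> 0
   it is a quadratic Gauss sum: in its squared modulus, the substitution
   n = m + h makes the sum over m linear with frequency 2 k h, so only h = 0
   contributes and the value is p.  On the other side, m - n = c and
   m^2 - n^2 = d force m + n = d / c when c <> 0, giving exactly one pair. *)
Require Import Defs.
From mathcomp Require Import all_boot all_order all_algebra.
From mathcomp Require Import complex reals ring.

Import GRing.Theory Num.Theory.
Local Open Scope ring_scope.

Section ExponentialSums.
Variables (R : realType) (p : nat).
Hypothesis p_gt1 : (1 < p)%N.

(** Translating the index by 1 multiplies the sum [s] by [zeta R p ^+ k]. This factor differs from 1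
    when [k != 0], which forces [s] to vanish. *)
Lemma zeta_Zp_sum (k : 'Z_p) :
  \sum_(a : 'Z_p) zeta R p ^+ (k * a)%R = if k == 0 then p%:R else 0.
Proof.
case: eqVneq => [-> | k_neq0].
  under eq_bigr do rewrite mul0r expr0.
  by rewrite sumr_const card_ord Zp_cast.
set s := \sum_a _; have : zeta R p ^+ k * s = s.
  rewrite /s mulr_sumr [RHS](reindex_inj (addrI 1)).
  by apply: eq_bigr => a _; rewrite mulrDr mulr1 zeta_ZpD.
move/eqP; rewrite -subr_eq0 -{2}[s]mul1r -mulrBl mulf_eq0 subr_eq0.
case/orP => [/eqP ek1 | /eqP//].
by case/eqP: k_neq0; apply: (zeta_Zp_inj (R := R) p_gt1); rewrite ek1 expr0.
Qed.

Lemma conj_zeta_Zp (a : 'Z_p) : (zeta R p ^+ a)^*%R = zeta R p ^+ (- a)%R.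
Proof.
have e_norm : `|zeta R p ^+ a| = 1 by rewrite normrX norm_expi expr1n.
have e_neq0 : zeta R p ^+ a != 0 by rewrite -normr_eq0 e_norm oner_eq0.
apply: (mulfI e_neq0).
by rewrite -normCK e_norm expr1n -zeta_ZpD // subrr expr0.
Qed.

Lemma normsq_zeta_quadratic_sum (k l : 'Z_p) : 2 * k \is a GRing.unit ->
  `|\sum_(n : 'Z_p) zeta R p ^+ (k * n ^+ 2 + l * n)%R| ^+ 2 = p%:R.
Proof.
move=> k2_unit; rewrite normCK rmorph_sum mulr_sumr.
(* Here [m] indexes the conjugated factor. In k(m+h)^2 + l(m+h) - km^2 - lm the square of m cancels,
   and only 2khm still depends on m. *)
transitivity (\sum_(m : 'Z_p) \sum_(h : 'Z_p)
    zeta R p ^+ (k * h ^+ 2 + l * h)%R * zeta R p ^+ (2 * k * h * m)%R).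
  apply: eq_bigr => m _; apply: etrans (congr1 _ (conj_zeta_Zp _)) _.
  rewrite mulr_suml.
  rewrite (reindex_inj (addrI m)); apply: eq_bigr => h _.
  by rewrite -!zeta_ZpD //; congr (_ ^+ nat_of_ord _); ring.
rewrite exchange_big.
transitivity (\sum_(h : 'Z_p) if h == 0 then p%:R else 0 : R[i]).
  apply: eq_bigr => h _; rewrite -mulr_sumr zeta_Zp_sum.
  rewrite (_ : (2 * k * h == 0) = (h == 0)); last first.
    by rewrite -(inj_eq (mulrI k2_unit) h 0) mulr0.
  case: eqP => [-> | _]; last by rewrite mulr0.
  by rewrite !expr2 !mulr0 addr0 expr0 mul1r.
by rewrite -big_mkcond big_pred1_eq.
Qed.

End ExponentialSums.

Lemma unitZp_prime (p : nat) (a : 'Z_p) : prime p ->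
  (a \is a GRing.unit) = (a != 0).
Proof.
move=> p_prime; have p_gt1 := prime_gt1 p_prime.
rewrite -[a in LHS]natr_Zp unitZpE // prime_coprime //.
rewrite -[a == 0]/(a == 0 :> nat); case: (posnP a) => [-> | a_gt0].
  by rewrite dvdn0.
by rewrite gtnNdvd ?gtn_eqF // -[X in (_ < X)%N](Zp_cast p_gt1).
Qed.

(** Points with parameters n + c and n differ by (c, c(c + 2n)), so the pairs correspond to the
    solutions n of c(c + 2n) = d. *)
Lemma card_parabola_differences (p : nat) (c d : 'Z_p) :
  (1 < p)%N -> (2 : 'Z_p) \is a GRing.unit ->
  c = 0 \/ c \is a GRing.unit ->
  let T := [set (n, n ^+ 2) | n in [set: 'Z_p]] in
  #|[set w in setX T T | (c, d) == w.1 - w.2]|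
    = if c == 0 then if d == 0 then p else 0%N else 1%N.
Proof.
move=> p_gt1 unit2 c_spec T.
have -> : [set w in setX T T | (c, d) == w.1 - w.2]
    = [set ((n + c, (n + c) ^+ 2), (n, n ^+ 2))
        | n in [set n : 'Z_p | c * (c + 2 * n) == d]].
  apply/setP => -[w1 w2]; rewrite !inE /=; apply/idP/imsetP.
    case/andP => /andP[/imsetP[m _ ->] /imsetP[n _ ->]] /eqP[cE dE].
    exists n; last by rewrite cE addrCA subrr addr0.
    by rewrite inE cE dE; apply/eqP; ring.
  case=> n; rewrite inE => /eqP <- [-> ->].
  rewrite !imset_f ?inE //=; apply/eqP; congr (_, _) => /=.
    by rewrite -[LHS]/c -[RHS]/(n + c - n); ring.
  by rewrite -[RHS]/((n + c) ^+ 2 - n ^+ 2); ring.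
rewrite card_imset; last by move=> m n [].
case: c_spec => [-> | c_unit].
  (* For c = 0 the equation reads 0 = d, so either every n solves it or none does. *)
  rewrite eqxx; under eq_finset do rewrite mul0r eq_sym.
  case: eqP => _; last first.
    by apply/eqP; rewrite cards_eq0; apply/eqP/setP => n; rewrite !inE.
  rewrite -[RHS](Zp_cast p_gt1) -[RHS]card_ord -cardsT.
  by apply: eq_card => n; rewrite !inE.
have -> : (c == 0) = false.
  by apply/negP => /eqP c0; rewrite c0 unitr0 in c_unit.
(* The witness is c(c + 2n) = d solved for n, by inverting c and then 2. *)
apply/eqP/cards1P; exists (2^-1 * (c^-1 * d - c)); apply/setP => n.
rewrite !inE; apply/eqP/eqP => [<- | ->].
  by rewrite mulKr // addrAC subrr add0r mulKr.
by rewrite mulVKr // addrCA subrr addr0 mulVKr.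
Qed.

Theorem theorem3p2 (R : realType) (p : nat) (p_prime : prime p) (p_odd : odd p)
    (alpha beta : 'Z_p) (alpha_neq0 : alpha != 0) (beta_neq0 : beta != 0) :
  formally_dual (Zp2_pairing R (prime_gt1 p_prime))
    [set (alpha * n ^+ 2, beta * n) | n in [set: 'Z_p]]
    [set (n, n ^+ 2) | n in [set: 'Z_p]].
Proof.
have p_gt1 := prime_gt1 p_prime.
have p_neq0 : p%:R != 0 :> R[i].
  by rewrite pnatr_eq0 -lt0n prime_gt0.
have cardZ : #|[set: 'Z_p]| = p by rewrite cardsT card_ord Zp_cast.
have alpha_unit : alpha \is a GRing.unit by rewrite unitZp_prime.
have beta_unit : beta \is a GRing.unit by rewrite unitZp_prime.
(* Oddness of [p] enters here. *)
have unit2 : (2 : 'Z_p) \is a GRing.unit by rewrite unitZpE // coprimen2.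
(* Injectivity of the parametrizations gives both sets cardinality [p]; that of S also turns its
   character sum into a sum over n. *)
have S_inj : injective (fun n : 'Z_p => (alpha * n ^+ 2, beta * n)).
  by move=> m n /(congr1 snd)/(mulrI beta_unit).
have T_inj : injective (fun n : 'Z_p => (n, n ^+ 2)) by move=> m n [].
split; rewrite -?card_gt0 ?card_imset ?cardZ ?prime_gt0 // => -[c d].
have c_spec : c = 0 \/ c \is a GRing.unit.
  by rewrite unitZp_prime //; case: eqVneq; [left | right].
rewrite card_parabola_differences // big_imset /=; last first.
  by move=> ? ? _ _; apply: S_inj.
rewrite normrM exprMn normfV normr_nat.
have -> : \sum_(n in [set: 'Z_p])
      Zp2_pairing_fun R (alpha * n ^+ 2, beta * n) (c, d)
    = \sum_(n : 'Z_p) zeta R p ^+ (alpha * c * n ^+ 2 + beta * d * n)%R.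
  apply: eq_big => [n | n _]; first by rewrite inE.
  rewrite /Zp2_pairing_fun; congr (_ ^+ nat_of_ord _).
  by rewrite -[LHS]/(alpha * n ^+ 2 * c + beta * n * d); ring.
case: eqVneq => [-> | c_neq0].
  (* For c = 0 both sides equal 1 if d = 0, and 0 otherwise. *)
  under eq_bigr do rewrite mulr0 mul0r add0r.
  rewrite zeta_Zp_sum // -(inj_eq (mulrI beta_unit) d 0) mulr0.
  case: ifP => _; last by rewrite normr0 expr0n mulr0n !mulr0.
  by rewrite normr_nat -exprMn mulVf // expr1n.
(* For c nonzero both sides equal 1/p: the left is p/p^2, the right counts a single pair. *)
rewrite normsq_zeta_quadratic_sum //; first by rewrite expr2 -mulrA mulVf.
by rewrite !unitrM unit2 alpha_unit unitZp_prime.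
Qed.
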